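(* Let $\kappa_i=1$ for all $i\in[N]$. For every $x\in\mathcal{X}_C$ there exist $r\in\mathbb{R}^N$ and $s\in\mathbb{R}$ such that $(x,r,s)$ satisfies all the FICA constraints (F1)–(F6) defined in the context.
   Context: Notation: $[m]=\{1,\dots,m\}$ for a positive integer $m$. Let $N,P,K,n,T\ge 1$ be integers, $\epsilon\in(0,1)$ a risk level, $\theta\ge 0$ a Wasserstein radius, and $k=\lfloor \epsilon N\rfloor$. Let $\|\cdot\|$ be a norm on $\mathbb{R}^K$ with dual norm $\|\cdot\|_*$. Let $\xi_1,\dots,\xi_N\in\mathbb{R}^K$ be data samples. For each $p\in[P]$ let $b_p\in\mathbb{R}^K$, $A_p\in\mathbb{R}^{n\times K}$, $d_p\in\mathbb{R}$, $a_p\in\mathbb{R}^n$ be given; the decision vector is $x\in\mathbb{R}^n$ (so $b_p-A_p^\top x\in\mathbb{R}^K$). One-dimensional structure: the random vector $\xi$ has coordinates $e_{t,w}$, $t\in[T]$, $w\in\mathcal{W}$ (a finite set), so $K=T|\mathcal{W}|$, and among the coordinates of $x$ are variables $\alpha_{t,g}$, $t\in[T]$, $g\in\mathcal{G}$ (a finite set). A subset $[P]^*\subseteq[P]$ is given such that for each $p\in[P]^*$ there are $t\in[T]$, $g\in\mathcal{G}$ and a sign $\sigma_p\in\{+1,-1\}$ with $$(b_p-A_p^\top x)^\top\xi=\sigma_p\,\alpha_{t,g}\sum_{w\in\mathcal{W}}e_{t,w}\qquad\text{for all }x\in\mathbb{R}^n,\ \xi\in\mathbb{R}^K.$$ Ordering: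 for each $p\in[P]^*$ let $\pi_p$ be a permutation of $[N]$ such that, with $\mathbf{1}\in\mathbb{R}^n$ the all-ones vector, $(b_p-A_p^\top\mathbf{1})^\top\xi_{\pi_p(1)}\le\cdots\le(b_p-A_p^\top\mathbf{1})^\top\xi_{\pi_p(N)}$. Define $[N]_p=\{\pi_p(1),\dots,\pi_p(k)\}\cup\{\pi_p(N-k+1),\dots,\pi_p(N)\}$. FICA constraints on $(x,r,s)$, with $r=(r_i)_{i\in[N]}$ and hyperparameters $\kappa_i$: (F1) $s\ge0$ and $r_i\ge0$ for all $i\in[N]$; (F2) $\epsilon N s-\sum_{i\in[N]}r_i\ge\theta N\max_{p\in[P]}\|b_p-A_p^\top x\|_*$; (F3) $\kappa_i\big((b_p-A_p^\top x)^\top\xi_i+d_p-a_p^\top x\big)\ge s-r_i$ for all $p\in[P]^*$, $i\in[N]_p$; (F4) $\kappa_i\big((b_p-A_p^\top x)^\top\xi_i+d_p-a_p^\top x\big)\ge s-r_i$ for all $p\in[P]\setminus[P]^*$, $i\in[N]$; (F5) $(b_p-A_p^\top x)^\top\xi_{\pi_p(k+1)}+d_p-a_p^\top x\ge s$ for all $p\in[P]^*$; (F6) $(b_p-A_p^\top x)^\top\xi_{\pi_p(N-k)}+d_p-a_p^\top x\ge s$ for all $p\in[P]^*$. CVaR feasible region: $\mathcal{X}_C$ is the set of $x\in\mathbb{R}^n$ for which there exist $s\in\mathbb{R}$ and $r\in\mathbb{R}^N$ with (C1) $r_i\ge0$ for all $i\in[N]$ and $s\ge0$; (C2) $\epsilon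 N s-\sum_{i\in[N]}r_i\ge\theta N\max_{p\in[P]}\|b_p-A_p^\top x\|_*$; (C3) $(b_p-A_p^\top x)^\top\xi_i-a_p^\top x+d_p\ge s-r_i$ for all $i\in[N]$, $p\in[P]$.
   Formalization: The added condition εN ≤ N − k with k = ⌊εN⌋ (automatic if ε ≤ 1/2) is assumed; without it the claim is false, e.g. N = 2, ε = 0.9, θ = 0.4, one-dimensional left-hand side xξ, ξ = (0, 1), x = 1. *)

(* Defs.v *)
From HB Require Import structures.
From mathcomp Require Import all_boot all_order all_algebra all_fingroup.
From mathcomp Require Import all_classical all_reals.

Set Implicit Arguments.
Unset Strict Implicit.
Unset Printing Implicit Defensive.

Import Order.TTheory GRing.Theory Num.Theory.
Local Open Scope ring_scope.

(* Index sets [m] = {1, ..., m} are rendered by 'I_m = {0, ..., m - 1}; position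
   j of the text is the ordinal of value j - 1. *)

Definition dotv (R : realType) (m : nat) (u v : 'cV[R]_m) : R :=
  (u^T *m v) ord0 ord0.

Definition is_norm (R : realType) (m : nat) (nu : 'cV[R]_m -> R) : Prop :=
  [/\ forall u v, nu (u + v) <= nu u + nu v,
      forall (c : R) u, nu (c *: u) = `|c| * nu u
    & forall u, nu u = 0 -> u = 0].

Definition dual_norm (R : realType) (m : nat) (nu : 'cV[R]_m -> R)
    (z : 'cV[R]_m) : R :=
  sup [set dotv z u | u in [set u : 'cV[R]_m | nu u <= 1]]%classic.

Record data (R : realType) (N P K n : nat) := Data {
  eps : R;
  theta : R;
  nrm : 'cV[R]_K -> R;
  sample : 'I_N -> 'cV[R]_K;
  bvec : 'I_P -> 'cV[R]_K;
  Amat : 'I_P -> 'M[R]_(n, K);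
  dsc : 'I_P -> R;
  avec : 'I_P -> 'cV[R]_n }.

Section Constraints.
Context (R : realType) (N P K n : nat) (D : data R N P K n).

(* Num.truncn is the floor on nonnegative arguments. *)
Definition kfloor : nat := Num.truncn (eps D * N%:R).

Definition coefv (p : 'I_P) (x : 'cV[R]_n) : 'cV[R]_K :=
  bvec D p - (Amat D p)^T *m x.

Definition lhs (p : 'I_P) (x : 'cV[R]_n) (i : 'I_N) : R :=
  dotv (coefv p x) (sample D i) + dsc D p - dotv (avec D p) x.

(* The default value 0 of the iterated maximum is harmless: dual norms are
   nonnegative and P >= 1 is assumed wherever this is used. *)
Definition max_dual (x : 'cV[R]_n) : R :=
  \big[Num.max/0]_(p < P) dual_norm (nrm D) (coefv p x).

Definition budget (x : 'cV[R]_n) (r : 'I_N -> R) (s : R) : Prop :=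
  eps D * N%:R * s - \sum_(i < N) r i >= theta D * N%:R * max_dual x.

Definition CVaR_region (x : 'cV[R]_n) : Prop :=
  exists (s : R) (r : 'I_N -> R),
    [/\ (forall i, 0 <= r i) /\ 0 <= s,
        budget x r s
      & forall (i : 'I_N) (p : 'I_P), lhs p x i >= s - r i].

Definition one_dim_structure (Pstar : {set 'I_P}) (T : nat) (W G : finType)
    (e : 'I_T * W -> 'I_K) (alpha : 'I_T * G -> 'I_n) : Prop :=
  forall p, p \in Pstar ->
    exists (t : 'I_T) (g : G) (sigma : R),
      (sigma = 1 \/ sigma = -1) /\
      forall (x : 'cV[R]_n) (xi : 'cV[R]_K),
        dotv (coefv p x) xi =
        sigma * x (alpha (t, g)) ord0 * \sum_(w : W) xi (e (t, w)) ord0.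

Definition sorts_samples (Pstar : {set 'I_P}) (pi : 'I_P -> {perm 'I_N}) : Prop :=
  forall p, p \in Pstar -> forall i j : 'I_N, (i <= j)%N ->
    dotv (coefv p (const_mx 1)) (sample D (pi p i)) <=
    dotv (coefv p (const_mx 1)) (sample D (pi p j)).

Definition tails (pi : 'I_P -> {perm 'I_N}) (p : 'I_P) : {set 'I_N} :=
  [set pi p j | j : 'I_N & (j < kfloor)%N] :|:
  [set pi p j | j : 'I_N & (N - kfloor <= j)%N].

(* In the last two clauses j is the ordinal of value kfloor, respectively
   N - kfloor - 1, i.e. position k + 1, respectively N - k. It exists and is
   unique when 0 < N and 0 < eps < 1, for then kfloor < N. *)
Definition FICA (Pstar : {set 'I_P}) (pi : 'I_P -> {perm 'I_N})
    (kappa : 'I_N -> R) (x : 'cV[R]_n) (r : 'I_N -> R) (s : R) : Prop :=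
  [/\ 0 <= s /\ (forall i, 0 <= r i),
      budget x r s,
      forall p, p \in Pstar -> forall i, i \in tails pi p ->
        kappa i * lhs p x i >= s - r i,
      forall p, p \notin Pstar -> forall i,
        kappa i * lhs p x i >= s - r i
    & (forall p, p \in Pstar -> forall j : 'I_N, j = kfloor :> nat ->
        lhs p x (pi p j) >= s) /\
      (forall p, p \in Pstar -> forall j : 'I_N, j.+1 = (N - kfloor)%N ->
        lhs p x (pi p j) >= s)].

End Constraints.

(* Main.v *)
(* With m_i = min_p lhs p x i, constraint (C3) says r_i >= max 0 (s - m_i), and
   s |-> eps N s - sum_i max 0 (s - m_i) is concave and maximal at any quantile
   v with #{m_i < v} < eps N <= #{m_i <= v}. Taking s = v and
   r_i = max 0 (v - m_i) therefore keeps the budget. The one-dimensional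
   structure makes j |-> lhs p x (pi p j) monotone or antitone, according to the
   sign of alpha. If it were below v at position k + 1 or N - k, it would
   be below v at k + 1 or N - k positions or more, that is at no fewer than
   eps N positions, which contradicts the choice of v. *)

Require Import Defs.
From mathcomp Require Import all_boot all_order all_algebra all_fingroup.
From mathcomp Require Import all_classical all_reals.
From mathcomp Require Import zify ring lra.

Import Order.TTheory GRing.Theory Num.Theory.
Local Open Scope ring_scope.

Set Implicit Arguments.
Unset Strict Implicit.

(** Take [v] as the least value of [m] with at least [c] indices at or below it; the largest value
    qualifies because [c <= #|I|]. *)
Lemma exists_quantile (R : realDomainType) (I : finType) (m : I -> R) (c : R) :
  0 < c <= #|I|%:R ->
  exists v, #|[set i | m i < v]|%:R < c <= #|[set i | m i <= v]|%:R.
Proof.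
move=> /andP[c_gt0 c_le].
have [i0 _] : exists i : I, i \in I.
  by apply/card_gt0P; rewrite -(ltr0n R) (lt_le_trans c_gt0).
pose P i := c <= #|[set j | m j <= m i]|%:R.
have Pmax : P [arg max_(i > i0) m i]%O.
  case: Order.TotalTheory.arg_maxP => // i _ i_max; rewrite /P.
  suff -> : [set j | m j <= m i] = [set: I] by rewrite cardsT.
  by apply/setP => j; rewrite !inE; apply: i_max.
have [i Pi i_min] := Order.TotalTheory.arg_minP m Pmax.
exists (m i); apply/andP; split=> //.
have [l0 l0i|none] := pickP [pred j | m j < m i]; last first.
  rewrite (_ : [set _ | _] = finset.set0) ?cards0 //.
  by apply/setP => j; rewrite !inE; have /= -> := none j.
have [l /= li l_max] :=
  @Order.TotalTheory.arg_maxP _ _ _ l0 [pred j | m j < m i] m l0i.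
(* Lying below [m i] means being at most [m l], the next smaller value, where minimality of [m i]
   rules out [c] indices. *)
rewrite (_ : [set _ | _] = [set j | m j <= m l]).
  by rewrite ltNge; apply/negP => /i_min; rewrite leNgt li.
by apply/setP => j; rewrite !inE; apply/idP/idP => [/(l_max _)|/le_lt_trans->].
Qed.

Lemma sum_indicator (R : pzSemiRingType) (I : finType) (A : {set I}) (a : R) :
  \sum_i a * (i \in A)%:R = a * #|A|%:R.
Proof. by rewrite -mulr_sumr -natr_sum -sum1_card [in RHS]big_mkcond. Qed.

Section Quantile.
Context (R : realDomainType) (I : finType) (m : I -> R) (c v : R).
Hypothesis v_lt : #|[set i | m i < v]|%:R < c.
Hypothesis v_le : c <= #|[set i | m i <= v]|%:R.
Context (s : R) (r : I -> R).
Hypothesis r_ge0 : forall i, 0 <= r i.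
Hypothesis r_ge : forall i, s - m i <= r i.

(** Moving from [s] to [v] changes [c * s] by [(v - s) * c] and is charged [v - s] at each index of
    a set [A]: the strict sublevel set (fewer than [c] elements) when moving up, the weak one (at
    least [c]) when moving down. *)
Lemma quantile_maximizes :
  c * s - \sum_i r i <= c * v - \sum_i Num.max 0 (v - m i).
Proof.
suff [A [cA leA]] : exists A : {set I}, (v - s) * #|A|%:R <= (v - s) * c /\
    forall i, Num.max 0 (v - m i) <= r i + (v - s) * (i \in A)%:R.
  have : \sum_i Num.max 0 (v - m i) <= \sum_i r i + (v - s) * #|A|%:R.
    by rewrite -sum_indicator -big_split; apply: ler_sum.
  lra.
have [sv|/ltW vs] := leP s v.
  exists [set i | m i < v]; split.
    by rewrite ler_wpM2l ?subr_ge0 // ltW.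
  move=> i; rewrite inE; have := r_ge0 i; have := r_ge i.
  by case: (ltP (m i) v) => mv /=; rewrite ge_max => *; apply/andP; split; lra.
exists [set i | m i <= v]; split.
  by rewrite ler_wnM2l ?subr_le0.
move=> i; rewrite inE; have := r_ge0 i; have := r_ge i.
by case: (leP (m i) v) => mv /=; rewrite ge_max => *; apply/andP; split; lra.
Qed.

(** If [v < 0], the indices with [m i <= v], at least [c] of them, each have [r i >= s - v], so the
    sum of [r] is at least [c * (s - v) > c * s]. *)
Lemma quantile_ge0 :
  0 < c -> 0 <= s -> 0 <= c * s - \sum_i r i -> 0 <= v.
Proof.
move=> c_gt0 s_ge0 budget; rewrite leNgt; apply/negP => v_lt0.
have : (s - v) * #|[set i | m i <= v]|%:R <= \sum_i r i.
  rewrite -sum_indicator; apply: ler_sum => i _; rewrite inE.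
  have := r_ge0 i; have := r_ge i.
  by case: (leP (m i) v) => /= *; lra.
have : (s - v) * c <= (s - v) * #|[set i | m i <= v]|%:R.
  by rewrite ler_wpM2l // subr_ge0; lra.
have : 0 < c * - v by rewrite mulr_gt0 // oppr_gt0.
lra.
Qed.

End Quantile.

Lemma homo_position_ge (R : realDomainType) (N : nat) (m f : 'I_N -> R)
    (pi : {perm 'I_N}) (c v : R) (j : 'I_N) :
  #|[set i | m i < v]|%:R < c -> (forall i, m i <= f i) ->
  {homo f \o pi : i l / (i <= l)%N >-> i <= l} -> c <= j.+1%:R ->
  v <= f (pi j).
Proof.
move=> v_lt mf f_homo cj; rewrite leNgt; apply/negP => fv.
suff : (j.+1 <= #|[set i | (m i < v)%R]|)%N.
  by rewrite -(ler_nat R) leNgt (lt_le_trans v_lt).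
have <- : #|[set pi (widen_ord (ltn_ord j) l) | l : 'I_j.+1]| = j.+1.
  rewrite card_imset ?card_ord // => l l' /perm_inj/(congr1 val) /= ll'.
  exact: val_inj.
apply/subset_leq_card/fintype.subsetP => _ /imsetP[l _ ->]; rewrite inE.
apply: le_lt_trans (mf _) (le_lt_trans _ fv).
by apply: f_homo; rewrite /= -ltnS.
Qed.

(** Reversing the positions reduces this to the monotone case: [j] becomes [N - j - 1], whose
    successor is [N - j]. *)
Lemma antihomo_position_ge (R : realDomainType) (N : nat) (m f : 'I_N -> R)
    (pi : {perm 'I_N}) (c v : R) (j : 'I_N) :
  #|[set i | m i < v]|%:R < c -> (forall i, m i <= f i) ->
  {homo f \o pi : i l / (i <= l)%N >-> l <= i} -> c <= (N - j)%:R ->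
  v <= f (pi j).
Proof.
move=> v_lt mf f_anti cj.
pose rho := perm (@rev_ord_inj N).
have -> : pi j = (rho * pi)%g (rev_ord j) by rewrite permM permE rev_ordK.
apply: homo_position_ge v_lt mf _ _ => [i l il|].
  by rewrite /= !permM !permE; apply: f_anti; rewrite /= leq_sub2l.
by rewrite /= subnSK.
Qed.

Lemma max_dual_ge0 (R : realType) (N P K n : nat) (D : data R N P K n) x :
  0 <= max_dual D x.
Proof. exact: bigmax_ge_id. Qed.

(** At the all-ones vector the [alpha] factor is 1, so the product at [x] is that factor times the
    product by which [pi p] sorts; [sigma] is absorbed. *)
Lemma lhs_sample_monotone (R : realType) (N P K n T : nat) (D : data R N P K n)
    (W G : finType) (e : 'I_T * W -> 'I_K) (alpha : 'I_T * G -> 'I_n)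
    (Pstar : {set 'I_P}) (pi : 'I_P -> {perm 'I_N}) p x :
  one_dim_structure D Pstar e alpha -> sorts_samples D Pstar pi ->
  p \in Pstar ->
  {homo lhs D p x \o pi p : i l / (i <= l)%N >-> i <= l} \/
  {homo lhs D p x \o pi p : i l / (i <= l)%N >-> l <= i}.
Proof.
move=> hstruct hpi pP; have [t [g [sigma [_ coefE]]]] := hstruct _ pP.
have scale i : dotv (coefv D p x) (sample D i) =
    x (alpha (t, g)) ord0 * dotv (coefv D p (const_mx 1)) (sample D i).
  by rewrite !coefE mxE; ring.
case: (leP 0 (x (alpha (t, g)) ord0)) => [x0|/ltW x0]; [left|right];
  move=> i l il; rewrite /= /lhs !lerD2r !scale.
  by rewrite ler_wpM2l // hpi.
by rewrite ler_wnM2l // hpi.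
Qed.

Unset Implicit Arguments.
Set Strict Implicit.

Theorem theorem1 (R : realType) (N P K n T : nat)
  (hN : (0 < N)%N) (hP : (0 < P)%N) (hK : (0 < K)%N) (hn : (0 < n)%N)
  (hT : (0 < T)%N)
  (D : data R N P K n)
  (heps : 0 < eps D < 1) (htheta : 0 <= theta D) (hnrm : is_norm (nrm D))
  (* Added: eps N + floor (eps N) <= N. It follows from eps <= 1/2 or from
     2 k < N; whenever it fails, the claim has counterexamples. *)
  (htail : eps D * N%:R <= (N - kfloor D)%:R)
  (W G : finType)
  (e : 'I_T * W -> 'I_K) (he : bijective e)
  (alpha : 'I_T * G -> 'I_n) (halpha : injective alpha)
  (Pstar : {set 'I_P}) (hstruct : one_dim_structure D Pstar e alpha)
  (pi : 'I_P -> {perm 'I_N}) (hpi : sorts_samples D Pstar pi)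
  (kappa : 'I_N -> R) (hkappa : forall i, kappa i = 1)
  (x : 'cV[R]_n) (hx : CVaR_region D x) :
  exists (r : 'I_N -> R) (s : R), FICA D Pstar pi kappa x r s.
Proof.
have [eps_gt0 eps_lt1] := andP heps.
have [s [r [[r_ge0 s_ge0] s_budget s_le]]] := hx.
set c := eps D * N%:R in htail.
have N_gt0 : 0 < N%:R :> R by rewrite ltr0n.
have c_gt0 : 0 < c by rewrite mulr_gt0.
have c_le : c <= #|'I_N|%:R by rewrite card_ord ler_piMl // ltW.
have c_ltS : c <= (kfloor D).+1%:R by rewrite ltW // truncnS_gt.
pose m i := lhs D [arg min_(p < Ordinal hP) lhs D p x i]%O x i.
have m_le p i : m i <= lhs D p x i.
  by rewrite /m; case: Order.TotalTheory.arg_minP => // q _; apply.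
have r_ge i : s - m i <= r i by rewrite lerBlDr -lerBlDl s_le.
have [|v /andP[v_lt v_le]] := @exists_quantile _ _ m c; first by rewrite c_gt0.
have budget_ge0 : 0 <= theta D * N%:R * max_dual D x.
  by rewrite !mulr_ge0 ?max_dual_ge0.
have v_ge0 : 0 <= v.
  apply: (quantile_ge0 v_le r_ge0 r_ge c_gt0 s_ge0).
  exact: le_trans budget_ge0 s_budget.
pose r' i := Num.max 0 (v - m i).
have r'_ge p i : v - r' i <= lhs D p x i.
  have : v - m i <= r' i by rewrite le_max lexx orbT.
  have := m_le p i; lra.
have position_ge p (j : 'I_N) : p \in Pstar ->
    c <= j.+1%:R -> c <= (N - j)%:R -> v <= lhs D p x (pi p j).
  move=> pP cj cNj.
  have [homo|anti] := lhs_sample_monotone x hstruct hpi pP.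
    exact: homo_position_ge v_lt (m_le p) homo cj.
  exact: antihomo_position_ge v_lt (m_le p) anti cNj.
exists r', v; split.
- by split=> // i; rewrite le_max lexx.
- exact: le_trans s_budget (quantile_maximizes v_lt v_le r_ge0 r_ge).
- by move=> p _ i _; rewrite hkappa mul1r.
- by move=> p _ i; rewrite hkappa mul1r.
(* With [k = kfloor D], the pair [j.+1], [N - j] is [k + 1], [N - k] in the first clause and the
   reverse in the second, so [c_ltS] and [htail] serve both. *)
split=> p pP j jE; apply: position_ge => //; rewrite ?jE //.
suff -> : (N - j = (kfloor D).+1)%N by [].
have := ltn_ord j; lia.
Qed.
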